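(* Let $N$ be a simply connected nilpotent Lie group of real dimension $4$ and let $\omega$ be a left invariant symplectic structure on $N$. Then $(N,\omega)$ admits a left invariant compatible Riemannian metric which is minimal.
   Context: Let $N$ be a simply connected nilpotent Lie group with Lie algebra $\mathfrak{n}$, Lie bracket $\mu$, $\dim\mathfrak n=2n$. A left invariant symplectic structure is identified with a non-degenerate skew-symmetric bilinear form $\omega$ on $\mathfrak{n}$ with $\omega(\mu(X,Y),Z)+\omega(\mu(Y,Z),X)+\omega(\mu(Z,X),Y)=0$ for all $X,Y,Z\in\mathfrak{n}$. A left invariant Riemannian metric is identified with an inner product $\langle\cdot,\cdot\rangle$ on $\mathfrak{n}$; it is compatible with $(N,\omega)$ if the endomorphism $J=J_{\langle\cdot,\cdot\rangle}$ of $\mathfrak n$ defined by $\omega(X,Y)=\langle X,JY\rangle$ satisfies $J^2=-I$. Let $\mathrm{Ric}_{\langle\cdot,\cdot\rangle}$ be the Ricci operator of $(N,\langle\cdot,\cdot\rangle)$ (as a symmetric endomorphism of $\mathfrak n$) and $\mathrm{sc}(\langle\cdot,\cdot\rangle)$ its scalar curvature. The anti-complexified Ricci operator is $\mathrm{Ric}^{ac}_{\langle\cdot,\cdot\rangle}=\frac12\left(\mathrm{Ric}_{\langle\cdot,\cdot\rangle}+J\,\mathrm{Ric}_{\langle\cdot,\cdot\rangle}J\right)$. A compatible metric $\langle\cdot,\cdot\rangle$ is called minimal if it minimizes $\operatorname{tr}\left(\mathrm{Ric}^{ac}_{\langle\cdot,\cdot\rangle'}\right)^2$ among all left invariant metrics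 $\langle\cdot,\cdot\rangle'$ compatible with $(N,\omega)$ and satisfying $\mathrm{sc}(\langle\cdot,\cdot\rangle')=\mathrm{sc}(\langle\cdot,\cdot\rangle)$. *)

(* Defs.v *)
From mathcomp Require Import all_boot all_order all_algebra.
From mathcomp Require Import reals.

Set Implicit Arguments.
Unset Strict Implicit.
Unset Printing Implicit Defensive.

Import Order.TTheory GRing.Theory Num.Theory.
Local Open Scope ring_scope.

(* A simply connected Lie group is represented by its Lie algebra (n, mu), and
   left invariant tensors by tensors on n. A left invariant metric is a
   positive definite symmetric form g : {dot n for idfun}. *)

Section LieAlgebra.
Variables (R : realType) (n : vectType R) (mu : {bilinear n -> n -> n}).

Definition is_lie_bracket : Prop :=
  (forall X, mu X X = 0) /\
  (forall X Y Z, mu X (mu Y Z) + mu Y (mu Z X) + mu Z (mu X Y) = 0).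

(* lower_central k.+1 = [n, lower_central k]; by bilinearity, brackets of
   basis vectors span it *)
Fixpoint lower_central (k : nat) : {vspace n} :=
  if k is k'.+1 then
    <<[seq mu X Y | X <- vbasis {:n}, Y <- vbasis (lower_central k')]>>%VS
  else fullv.

Definition is_nilpotent : Prop := exists k, lower_central k = 0%VS.

Definition is_symplectic_structure (omega : {skew_symmetric n}) : Prop :=
  nondegenerate omega /\
  forall X Y Z, omega (mu X Y) Z + omega (mu Y Z) X + omega (mu Z X) Y = 0.

End LieAlgebra.

Section LinearAlgebra.
Variables (R : realType) (n : vectType R).

Definition trace (A : n -> n) : R :=
  \sum_(i < \dim {:n}) coord (vbasis {:n}) i (A (vbasis {:n})`_i).

Definition gram (g : {dot n for idfun}) : 'M[R]_(\dim {:n}) :=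
  \matrix_(i, j) g (vbasis {:n})`_i (vbasis {:n})`_j.

(* The g-dual of a linear form phi; characterized by rieszP below. *)
Definition riesz (g : {dot n for idfun}) (phi : n -> R) : n :=
  let c := (\row_j phi (vbasis {:n})`_j) *m invmx (gram g) in
  \sum_i c 0 i *: (vbasis {:n})`_i.

Lemma gram_unit (g : {dot n for idfun}) : gram g \in unitmx.
Proof.
rewrite -row_free_unit -kermx_eq0; apply/eqP/row_matrixP=> k; rewrite row0.
set u := row k _.
have uG0 : u *m gram g = 0.
  by rewrite /u -row_mul mulmx_ker row0.
pose v : n := \sum_i u 0 i *: (vbasis {:n})`_i.
have gv0 (j : 'I_(\dim {:n})) : g v (vbasis {:n})`_j = 0.
  transitivity ((u *m gram g) 0 j); last by rewrite uG0 mxE.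
  rewrite [RHS]mxE /v linear_sumlz; apply: eq_bigr => i _.
  by rewrite linearZl_LR /= [gram g i j]mxE.
have gvv : g v v = 0.
  rewrite {2}/v linear_sumr big1 // => i _.
  by rewrite linearZr_LR /= gv0 mulr0.
have v0 : v = 0.
  by apply/eqP; apply: contraT => /(@neq0_dnorm_gt0 _ _ _ g); rewrite gvv ltxx.
have /freeP fr := basis_free (vbasisP {:n}).
by apply/rowP=> i; rewrite [RHS]mxE; apply: (fr (fun i => u 0 i) v0).
Qed.

Lemma rieszP (g : {dot n for idfun}) (phi : {scalar n}) (Y : n) :
  g (riesz g phi) Y = phi Y.
Proof.
rewrite [Y](coord_vbasis (memvf Y)) !linear_sum; apply: eq_bigr => j _.
rewrite !linearZ_LR /=; congr (_ * _).
rewrite /riesz; set c := _ *m _.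
transitivity ((c *m gram g) 0 j); last by rewrite mulmxKV ?gram_unit// mxE.
rewrite [RHS]mxE linear_sumlz; apply: eq_bigr => i _.
by rewrite linearZl_LR /= [gram g i j]mxE.
Qed.

End LinearAlgebra.

Section Curvature.
Variables (R : realType) (n : vectType R) (mu : {bilinear n -> n -> n}).
Implicit Type g : {dot n for idfun}.

(* Koszul formula on left invariant fields, where the derivatives of the
   constant functions g(X, Y) drop out *)
Definition levi_civita g (X Y : n) : n :=
  riesz g (fun Z => 2^-1 * (g (mu X Y) Z - g (mu Y Z) X + g (mu Z X) Y)).

Definition curvature g (X Y Z : n) : n :=
  levi_civita g X (levi_civita g Y Z) - levi_civita g Y (levi_civita g X Z)
  - levi_civita g (mu X Y) Z.

Definition ricci_form g (X Y : n) : R := trace (fun Z => curvature g Z X Y).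

Definition Ric g (X : n) : n := riesz g (ricci_form g X).

Definition sc g : R := trace (Ric g).

End Curvature.

Section Symplectic.
Variables (R : realType) (n : vectType R) (mu : {bilinear n -> n -> n}).
Variable omega : {skew_symmetric n}.
Implicit Type g : {dot n for idfun}.

(* The endomorphism J with omega X Y = g X (J Y) *)
Definition J_op g (Y : n) : n := riesz g (omega^~ Y).

Definition compatible g : Prop := forall X, J_op g (J_op g X) = - X.

Definition Ric_ac g (X : n) : n :=
  2^-1 *: (Ric mu g X + J_op g (Ric mu g (J_op g X))).

Definition minimal g : Prop :=
  compatible g /\
  forall g', compatible g' -> sc mu g' = sc mu g ->
    trace (Ric_ac g \o Ric_ac g) <= trace (Ric_ac g' \o Ric_ac g').

End Symplectic.

(* Main.v *)
Require Import Defs.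
From HB Require Import structures.
From mathcomp Require Import all_boot all_order all_algebra.
From mathcomp Require Import reals ring lra.

Set Implicit Arguments.
Unset Strict Implicit.
Unset Printing Implicit Defensive.

Import Order.TTheory GRing.Theory Num.Theory.
Local Open Scope ring_scope.

(* For every compatible metric, nilpotency and the cocycle condition give an
   orthonormal Darboux frame (a, b, c, e) in which the only brackets are
   [a, b] = s c + p e and [a, c] = q e. Then
     sc = - (s^2 + p^2 + q^2) / 2,
     tr (Ric^ac)^2 = 5/8 ((s^2 + p^2 + q^2)^2 - 2 s^2 q^2).
   If N is at most 2-step nilpotent, s q = 0 in all these frames, so tr (Ric^ac)^2
   is a function of sc and every compatible metric is minimal. Otherwise
   s^2 q^2 <= (s^2 + p^2 + q^2)^2 / 4 with equality iff p = 0 and s^2 = q^2, and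
   a change of Darboux frame produces a metric attaining equality. *)

(** * Frames and traces *)

Section Frame.
Variables (R : realType) (n : vectType R).

Definition comb (a b c e : n) (x y z w : R) : n :=
  x *: a + y *: b + z *: c + w *: e.

Lemma combD a b c e x y z w x' y' z' w' :
  comb a b c e x y z w + comb a b c e x' y' z' w' =
  comb a b c e (x + x') (y + y') (z + z') (w + w').
Proof.
rewrite /comb addrACA !scalerDl; congr (_ + _).
by rewrite addrACA; congr (_ + _); rewrite addrACA.
Qed.

Lemma combZ a b c e k x y z w :
  k *: comb a b c e x y z w = comb a b c e (k * x) (k * y) (k * z) (k * w).
Proof. by rewrite /comb !scalerDr !scalerA. Qed.

Lemma combB a b c e x y z w x' y' z' w' :
  comb a b c e x y z w - comb a b c e x' y' z' w' =
  comb a b c e (x - x') (y - y') (z - z') (w - w').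
Proof. by rewrite -scaleN1r combZ !mulN1r combD. Qed.

(** [rieszP] asks for a bundled linear form, whereas [levi_civita], [Ric] and [J_op] apply [riesz]
    to bare functions; here linearity enters as a hypothesis and is packed on the spot. *)
Lemma riesz_linearP (g : {dot n for idfun}) (phi : n -> R) Y :
  (forall k u v, phi (k *: u + v) = k * phi u + phi v) ->
  g (riesz g phi) Y = phi Y.
Proof.
move=> phi_lin.
pose m := GRing.isLinear.Build R n R *%R phi phi_lin.
pose psi : {scalar n} := HB.pack phi m.
exact: (rieszP g psi Y).
Qed.

Lemma form_combl (eps : bool) (f : {hermitian n for eps & idfun}) a b c e x y z w Y :
  f (comb a b c e x y z w) Y = x * f a Y + y * f b Y + z * f c Y + w * f e Y.
Proof. by rewrite /comb !linearDl !linearZl_LR. Qed.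

Lemma form_combr (eps : bool) (f : {hermitian n for eps & idfun}) a b c e x y z w Y :
  f Y (comb a b c e x y z w) = x * f Y a + y * f Y b + z * f Y c + w * f Y e.
Proof. by rewrite /comb !linearDr !linearZr_LR. Qed.

Lemma dotC (g : {dot n for idfun}) u v : g u v = g v u.
Proof. by rewrite hermC /= expr0 mul1r. Qed.

Lemma skewC (omega : {skew_symmetric n}) u v : omega u v = - omega v u.
Proof. by rewrite hermC /= expr1 mulN1r. Qed.

Lemma skewxx (omega : {skew_symmetric n}) u : omega u u = 0.
Proof. by have := skewC omega u u; lra. Qed.

(** Vectors produced by [riesz] are known only through their products with other vectors. Positive
    definiteness turns an identity between them into scalar identities that [ring] can close. *)
Lemma dot_inj (g : {dot n for idfun}) u v : (forall w, g u w = g v w) -> u = v.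
Proof.
move=> uv; apply/eqP; rewrite -subr_eq0; apply: contraT => /(@neq0_dnorm_gt0 _ _ _ g).
by rewrite linearBl /= uv subrr ltxx.
Qed.

(* [form_combl] and [form_combr] do not rewrite under the coercion of
   [{dot n for idfun}] to functions. *)
Lemma dot_combl (g : {dot n for idfun}) a b c e x y z w Y :
  g (comb a b c e x y z w) Y = x * g a Y + y * g b Y + z * g c Y + w * g e Y.
Proof. exact: form_combl. Qed.

Lemma dot_combr (g : {dot n for idfun}) a b c e x y z w Y :
  g Y (comb a b c e x y z w) = x * g Y a + y * g Y b + z * g Y c + w * g Y e.
Proof. exact: form_combr. Qed.

(** [trace] is tied to the arbitrary basis [vbasis]. Expanding each basis in the other and
    exchanging the two sums gives independence of the basis. *)
Lemma trace_basis (A : {linear n -> n}) k (B : k.-tuple n) :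
  basis_of {:n} B -> trace A = \sum_i coord B i (A B`_i).
Proof.
move=> Bb; rewrite /trace.
under eq_bigr => i _ do
  rewrite {1}(coord_basis Bb (memvf (vbasis {:n})`_i)) linear_sum linear_sum.
rewrite exchange_big; apply: eq_bigr => j _ /=.
rewrite [in RHS](coord_vbasis (memvf (A B`_j))) linear_sum /=.
by apply: eq_bigr => i _; rewrite !linearZ /= mulrC.
Qed.

Lemma comb_basis a b c e : \dim {:n} = 4%N ->
  (forall x y z w, comb a b c e x y z w = 0 -> [/\ x = 0, y = 0, z = 0 & w = 0]) ->
  basis_of {:n} [tuple a; b; c; e].
Proof.
move=> dim_n free_abce; rewrite basisEfree subvf dim_n leqnn !andbT.
apply/freeP => k; rewrite !big_ord_recl big_ord0 addr0 /= !addrA.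
move=> /free_abce[k0 k1 k2 k3].
case=> -[|[|[|[|//]]]] lt_i4;
  [rewrite -[RHS]k0|rewrite -[RHS]k1|rewrite -[RHS]k2|rewrite -[RHS]k3];
  by congr (k _); apply: val_inj.
Qed.

Lemma comb_coord a b c e X : basis_of {:n} [tuple a; b; c; e] ->
  exists x y z w, X = comb a b c e x y z w.
Proof.
move=> Bb; rewrite (coord_basis Bb (memvf X)) !big_ord_recl big_ord0 addr0 /= !addrA.
by do 4!eexists.
Qed.

End Frame.

(** * Coordinates and traces in an orthonormal frame of a four-dimensional space *)

Section OrthonormalFrame.
Variables (R : realType) (n : vectType R).
Hypothesis dim_n : \dim {:n} = 4%N.
Variables (g : {dot n for idfun}) (a b c e : n).

Record orthonormal_frame : Prop := OrthonormalFrame {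
  gaa : g a a = 1; gbb : g b b = 1; gcc : g c c = 1; gee : g e e = 1;
  gab : g a b = 0; gac : g a c = 0; gae : g a e = 0;
  gbc : g b c = 0; gbe : g b e = 0; gce : g c e = 0 }.

Hypothesis abce : orthonormal_frame.
Local Notation V := (comb a b c e).

Lemma dot_comb x y z w x' y' z' w' :
  g (V x y z w) (V x' y' z' w') = x * x' + y * y' + z * z' + w * w'.
Proof.
case: abce => aa bb cc ee ab ac ae bc be ce.
rewrite dot_combl !dot_combr (dotC _ b a) (dotC _ c a) (dotC _ e a).
rewrite (dotC _ c b) (dotC _ e b) (dotC _ e c) aa bb cc ee ab ac ae bc be ce.
by ring.
Qed.

Lemma frame_vectors : [/\ a = V 1 0 0 0, b = V 0 1 0 0, c = V 0 0 1 0 & e = V 0 0 0 1].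
Proof. by rewrite /comb !scale0r !scale1r !addr0 !add0r. Qed.

Lemma dot_frame x y z w (u := V x y z w) :
  [/\ g u a = x, g u b = y, g u c = z & g u e = w].
Proof.
have [ea eb ec ee] := frame_vectors.
have := (dot_comb x y z w 1 0 0 0, dot_comb x y z w 0 1 0 0,
         dot_comb x y z w 0 0 1 0, dot_comb x y z w 0 0 0 1).
rewrite -ea -eb -ec -ee !mulr0 !mulr1 !addr0 !add0r -/u.
by case=> [[[-> ->] ->] ->].
Qed.

Lemma orthonormal_basis : basis_of {:n} [tuple a; b; c; e].
Proof.
apply: comb_basis => // x y z w V0.
have dot0 x' y' z' w' : x * x' + y * y' + z * z' + w * w' = 0.
  by rewrite -dot_comb V0 linear0l.
have := (dot0 1 0 0 0, dot0 0 1 0 0, dot0 0 0 1 0, dot0 0 0 0 1).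
by rewrite !mulr0 !mulr1 !addr0 !add0r => -[[[-> ->] ->] ->].
Qed.

Lemma orthonormal_coord X : X = V (g X a) (g X b) (g X c) (g X e).
Proof.
have [x [y [z [w ->]]]] := comb_coord X orthonormal_basis.
by have [-> -> -> ->] := dot_frame x y z w.
Qed.

(** The frame vectors appear as [V 1 0 0 0] and so on, so that coordinate formulas for [A] rewrite
    every diagonal entry directly. *)
Lemma trace_frame (A : n -> n) :
  (forall k u v, A (k *: u + v) = k *: A u + A v) ->
  trace A = g (A (V 1 0 0 0)) (V 1 0 0 0) + g (A (V 0 1 0 0)) (V 0 1 0 0) +
    g (A (V 0 0 1 0)) (V 0 0 1 0) + g (A (V 0 0 0 1)) (V 0 0 0 1).
Proof.
move=> A_lin; have [<- <- <- <-] := frame_vectors.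
pose m := GRing.isLinear.Build R n n *:%R A A_lin.
pose A' : {linear n -> n} := HB.pack A m.
have Bb := orthonormal_basis.
have coordE i X : coord [tuple a; b; c; e] i X =
    [:: g X a; g X b; g X c; g X e]`_i.
  rewrite {1}[X]orthonormal_coord /comb !linearD !linearZ /=.
  have /basis_free Bf := Bb.
  rewrite (coord_free (Ordinal (isT : 0 < 4)%N) i Bf).
  rewrite (coord_free (Ordinal (isT : 1 < 4)%N) i Bf).
  rewrite (coord_free (Ordinal (isT : 2 < 4)%N) i Bf).
  rewrite (coord_free (Ordinal (isT : 3 < 4)%N) i Bf).
  by case: i => -[|[|[|[|//]]]] /= _; rewrite !mulr0 !mulr1 ?addr0 ?add0r.
by rewrite (trace_basis A' Bb) !big_ord_recl big_ord0 addr0 !coordE /= !addrA.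
Qed.

End OrthonormalFrame.

(** * Curvature in an adapted frame *)

Section LeviCivita.
Variables (R : realType) (n : vectType R) (mu : {bilinear n -> n -> n}).
Variable g : {dot n for idfun}.

Let dotDl u v w : g (u + v) w = g u w + g v w. Proof. exact: linearDl. Qed.
Let dotDr u v w : g w (u + v) = g w u + g w v. Proof. exact: linearDr. Qed.
Let dotZl k u w : g (k *: u) w = k * g u w. Proof. exact: linearZl_LR. Qed.
Let dotZr k u w : g w (k *: u) = k * g w u. Proof. exact: linearZr_LR. Qed.
Let muDl u v w : mu (u + v) w = mu u w + mu v w. Proof. exact: linearDl. Qed.
Let muDr u v w : mu w (u + v) = mu w u + mu w v. Proof. exact: linearDr. Qed.
Let muZl k u w : mu (k *: u) w = k *: mu u w. Proof. exact: linearZl_LR. Qed.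
Let muZr k u w : mu w (k *: u) = k *: mu w u. Proof. exact: linearZr_LR. Qed.
Let bilinE := (muDl, muDr, muZl, muZr, dotDl, dotDr, dotZl, dotZr).

Lemma koszul_linear X Y k u v
    (phi := fun Z => 2^-1 * (g (mu X Y) Z - g (mu Y Z) X + g (mu Z X) Y)) :
  phi (k *: u + v) = k * phi u + phi v.
Proof. by rewrite /phi !bilinE; ring. Qed.

Lemma levi_civitaP X Y Z : g (levi_civita mu g X Y) Z =
  2^-1 * (g (mu X Y) Z - g (mu Y Z) X + g (mu Z X) Y).
Proof. by rewrite riesz_linearP //; exact: koszul_linear. Qed.

Lemma levi_civita_linearl Y k u v : levi_civita mu g (k *: u + v) Y =
  k *: levi_civita mu g u Y + levi_civita mu g v Y.
Proof. by apply: (@dot_inj _ _ g) => w; rewrite !(bilinE, levi_civitaP); ring. Qed.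

Lemma levi_civita_linearr X k u v : levi_civita mu g X (k *: u + v) =
  k *: levi_civita mu g X u + levi_civita mu g X v.
Proof. by apply: (@dot_inj _ _ g) => w; rewrite !(bilinE, levi_civitaP); ring. Qed.

Lemma curvature_linear X Y k u v : curvature mu g (k *: u + v) X Y =
  k *: curvature mu g u X Y + curvature mu g v X Y.
Proof.
rewrite /curvature !bilinE !(levi_civita_linearl, levi_civita_linearr).
by rewrite !scalerBr !opprD [X in X + _ = _]addrACA [LHS]addrACA.
Qed.

End LeviCivita.

(** * Bracket, Ricci operator and anti-complexified Ricci operator in frame coordinates *)

Section AdaptedFrame.
Variables (R : realType) (n : vectType R).
Hypothesis dim_n : \dim {:n} = 4%N.
Variables (mu : {bilinear n -> n -> n}) (omega : {skew_symmetric n}).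
Hypothesis mu_lie : is_lie_bracket mu.

(** The dual pairs are [(a, e)] and [(b, c)], so [c] and [e] span a Lagrangian plane. In an adapted
    frame this plane contains the derived algebra. *)
Record darboux_frame (a b c e : n) : Prop := DarbouxFrame {
  omega_ae : omega a e = 1; omega_bc : omega b c = 1;
  omega_ab : omega a b = 0; omega_ac : omega a c = 0;
  omega_be : omega b e = 0; omega_ce : omega c e = 0 }.

Lemma omega_comb a b c e : darboux_frame a b c e ->
  forall x y z w x' y' z' w',
  omega (comb a b c e x y z w) (comb a b c e x' y' z' w') =
  x * w' - w * x' + (y * z' - z * y').
Proof.
case=> ae bc ab ac be ce x y z w x' y' z' w'.
rewrite form_combl !form_combr (skewC _ b a) (skewC _ c a) (skewC _ e a).
rewrite (skewC _ c b) (skewC _ e b) (skewC _ e c) !skewxx ae bc ab ac be ce.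
by ring.
Qed.

Lemma darboux_basis a b c e :
  darboux_frame a b c e -> basis_of {:n} [tuple a; b; c; e].
Proof.
move=> abce; apply: comb_basis => // x y z w V0.
have omega0 x' y' z' w' : x * w' - w * x' + (y * z' - z * y') = 0.
  by rewrite -(omega_comb abce) V0 linear0l.
have := (omega0 0 0 0 1, omega0 0 0 1 0, omega0 0 1 0 0, omega0 1 0 0 0).
by move=> [[[h1 h2] h3] h4]; split; lra.
Qed.

(** A common normal form for all the algebras concerned: filiform of step 3 when [s * q] is nonzero,
    otherwise abelian or the sum of a Heisenberg algebra and a line. *)
Record adapted_frame (a b c e : n) (s p q : R) : Prop := AdaptedFrame {
  adapted_darboux :> darboux_frame a b c e;
  mu_ab : mu a b = s *: c + p *: e; mu_ac : mu a c = q *: e;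
  mu_bc : mu b c = 0; mu_e : forall X, mu X e = 0 }.

Lemma bracketC X Y : mu X Y = - mu Y X.
Proof.
apply/eqP; rewrite -subr_eq0 opprK; have [mu0 _] := mu_lie.
have := mu0 (X + Y); rewrite linearDl !linearDr /= !mu0 add0r addr0.
by move->.
Qed.

Section Coordinates.
Variables (a b c e : n) (s p q : R).
Hypothesis abce : adapted_frame a b c e s p q.
Local Notation V := (comb a b c e).

Lemma bracket_comb x y z w x' y' z' w' :
  mu (V x y z w) (V x' y' z' w') =
  V 0 0 (s * (x * y' - y * x')) (p * (x * y' - y * x') + q * (x * z' - z * x')).
Proof.
have [mu0 _] := mu_lie; case: abce => _ ab ac bc me.
have zeroE : 0 = V 0 0 0 0 by rewrite /comb !scale0r !addr0.
have abE : mu a b = V 0 0 s p by rewrite ab /comb !scale0r !add0r.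
have acE : mu a c = V 0 0 0 q by rewrite ac /comb !scale0r !add0r.
have combN x1 x2 x3 x4 : - V x1 x2 x3 x4 = V (- x1) (- x2) (- x3) (- x4).
  by rewrite -scaleN1r combZ !mulN1r.
rewrite {1 2}/comb !linearDl !linearDr !linearZl_LR !linearZr_LR /=.
rewrite !mu0 !me !(bracketC e) !me (bracketC b a) (bracketC c a) (bracketC c b).
rewrite abE acE bc !oppr0 zeroE !combN !(combZ, combD).
by congr comb; ring.
Qed.

Variable g : {dot n for idfun}.
Hypothesis g_abce : orthonormal_frame g a b c e.

Lemma levi_civita_comb x y z w x' y' z' w' :
  levi_civita mu g (V x y z w) (V x' y' z' w') = V
    (2^-1 * (s * (y * z' + z * y') + p * (y * w' + w * y') + q * (z * w' + w * z')))
    (2^-1 * (- s * (x * z' + z * x') - p * (x * w' + w * x')))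
    (2^-1 * (s * (x * y' - y * x') - q * (x * w' + w * x')))
    (2^-1 * (p * (x * y' - y * x') + q * (x * z' - z * x'))).
Proof.
apply: (@dot_inj _ _ g) => Z; rewrite (orthonormal_coord dim_n g_abce Z).
by rewrite levi_civitaP !bracket_comb !(dot_comb g_abce); ring.
Qed.

Lemma ricci_form_comb x y z w x' y' z' w' :
  ricci_form mu g (V x y z w) (V x' y' z' w') =
  2^-1 * (- (s ^+ 2 + p ^+ 2 + q ^+ 2) * (x * x') - (s ^+ 2 + p ^+ 2) * (y * y')
    - p * q * (y * z' + z * y') + (s ^+ 2 - q ^+ 2) * (z * z')
    + s * p * (z * w' + w * z') + (p ^+ 2 + q ^+ 2) * (w * w')).
Proof.
rewrite /ricci_form (trace_frame dim_n g_abce); last exact: curvature_linear.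
by rewrite /curvature !bracket_comb !levi_civita_comb !combB !(dot_comb g_abce); field.
Qed.

Lemma Ric_comb x y z w : Ric mu g (V x y z w) = V
    (2^-1 * (- (s ^+ 2 + p ^+ 2 + q ^+ 2) * x))
    (2^-1 * (- (s ^+ 2 + p ^+ 2) * y - p * q * z))
    (2^-1 * (- (p * q) * y + (s ^+ 2 - q ^+ 2) * z + s * p * w))
    (2^-1 * (s * p * z + (p ^+ 2 + q ^+ 2) * w)).
Proof.
apply: (@dot_inj _ _ g) => Z; rewrite riesz_linearP.
  rewrite (orthonormal_coord dim_n g_abce Z) ricci_form_comb (dot_comb g_abce).
  by ring.
(* The linearity that [riesz_linearP] demands is read off the coordinate formula for the Ricci
   form. *)
move=> k u v; rewrite (orthonormal_coord dim_n g_abce u) (orthonormal_coord dim_n g_abce v).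
by rewrite combZ combD !ricci_form_comb; ring.
Qed.

Lemma sc_frame : sc mu g = - 2^-1 * (s ^+ 2 + p ^+ 2 + q ^+ 2).
Proof.
rewrite /sc (trace_frame dim_n g_abce); last first.
  move=> k u v; rewrite (orthonormal_coord dim_n g_abce u) (orthonormal_coord dim_n g_abce v).
  by rewrite combZ combD !Ric_comb combZ combD; congr comb; ring.
by rewrite !Ric_comb !(dot_comb g_abce); field.
Qed.

(** In particular [J] sends [e] to [a] and [c] to [b]; [compatible_adapted_frame] builds its frame
    from these two relations. *)
Lemma J_op_comb x y z w : J_op omega g (V x y z w) = V w z (- y) (- x).
Proof.
apply: (@dot_inj _ _ g) => Z; rewrite riesz_linearP.
  rewrite (orthonormal_coord dim_n g_abce Z) (omega_comb abce) (dot_comb g_abce).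
  by ring.
by move=> k u v; rewrite linearDl linearZl_LR.
Qed.

(** Supplies compatible metrics: it suffices to declare an adapted frame orthonormal. The converse
    direction is [compatible_adapted_frame]. *)
Lemma compatible_frame : compatible omega g.
Proof.
move=> X; rewrite (orthonormal_coord dim_n g_abce X) !J_op_comb.
by rewrite -scaleN1r combZ !mulN1r.
Qed.

Lemma Ric_ac_comb x y z w : Ric_ac mu omega g (V x y z w) = V
    (4^-1 * (- (s ^+ 2 + 2 * p ^+ 2 + 2 * q ^+ 2) * x - s * p * y))
    (4^-1 * (- s * p * x + (- 2 * s ^+ 2 - p ^+ 2 + q ^+ 2) * y - 2 * p * q * z))
    (4^-1 * (- 2 * p * q * y + (2 * s ^+ 2 + p ^+ 2 - q ^+ 2) * z + s * p * w))
    (4^-1 * (s * p * z + (s ^+ 2 + 2 * p ^+ 2 + 2 * q ^+ 2) * w)).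
Proof.
rewrite /Ric_ac J_op_comb !Ric_comb J_op_comb combD combZ.
by congr comb; field.
Qed.

Lemma trace_Ric_ac_frame : trace (Ric_ac mu omega g \o Ric_ac mu omega g) =
  5 / 8 * ((s ^+ 2 + p ^+ 2 + q ^+ 2) ^+ 2 - 2 * (s * q) ^+ 2).
Proof.
rewrite (trace_frame dim_n g_abce); last first.
  move=> k u v /=; rewrite (orthonormal_coord dim_n g_abce u) (orthonormal_coord dim_n g_abce v).
  by rewrite combZ combD !Ric_ac_comb combZ combD; congr comb; ring.
by rewrite /= !Ric_ac_comb !(dot_comb g_abce); field.
Qed.

End Coordinates.
End AdaptedFrame.

(** * Existence of adapted frames *)

Section MetricOfBasis.
Variables (R : realType) (n : vectType R) (k : nat) (B : k.-tuple n).

Definition coord_dot (u v : n) : R := \sum_i coord B i u * coord B i v.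

Lemma coord_dot_bilinear : bilinear_for
  (GRing.Scale.Law.clone _ _ *%R _) (GRing.Scale.Law.clone _ _ (idfun \; *%R) _)
  coord_dot.
Proof.
split=> [v|u] x u1 u2; rewrite /coord_dot /= mulr_sumr -big_split;
  by apply: eq_bigr => i _; rewrite linearP /=; ring.
Qed.

HB.instance Definition _ := bilinear_isBilinear.Build R n n R
  (GRing.Scale.Law.clone _ _ *%R _) (GRing.Scale.Law.clone _ _ (idfun \; *%R) _)
  coord_dot coord_dot_bilinear.

Lemma coord_dot_sym u v : coord_dot u v = (-1) ^+ false * idfun (coord_dot v u).
Proof.
by rewrite expr0 mul1r; apply: eq_bigr => i _; rewrite mulrC.
Qed.

HB.instance Definition _ :=
  isHermitianSesquilinear.Build R n false idfun coord_dot coord_dot_sym.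

Hypothesis B_basis : basis_of {:n} B.

Lemma coord_dot_gt0 u : u != 0 -> 0 < coord_dot u u.
Proof.
move=> u_neq0; have ge0 : 0 <= coord_dot u u.
  by apply: sumr_ge0 => i _; rewrite -expr2 sqr_ge0.
rewrite lt_neqAle ge0 andbT; apply: contraNneq u_neq0 => /esym /eqP.
rewrite psumr_eq0 => [/allP u0|i _]; last by rewrite -expr2 sqr_ge0.
apply/eqP; rewrite (coord_basis B_basis (memvf u)) big1 // => i _.
have := u0 i (mem_index_enum _); rewrite -expr2 sqrf_eq0 => /eqP ->.
by rewrite scale0r.
Qed.

Lemma metric_of_basis : exists g : {dot n for idfun},
  forall i j : 'I_k, g B`_i B`_j = (i == j)%:R.
Proof.
pose m := isDotProduct.Build R n coord_dot coord_dot_gt0.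
pose g : {dot n for idfun} := HB.pack coord_dot m.
exists g => i j; have Bf := basis_free B_basis.
rewrite -[LHS]/(coord_dot B`_i B`_j) /coord_dot (bigD1 i) //=.
rewrite !coord_free // eqxx mul1r big1 => [|l lneqi].
  by rewrite addr0 eq_sym.
by rewrite !coord_free // (eq_sym i) (negbTE lneqi) mul0r.
Qed.

End MetricOfBasis.

(** * Central flags and the adapted frames built on them *)

Section Frames.
Variables (R : realType) (n : vectType R).
Hypothesis dim_n : \dim {:n} = 4%N.
Variables (mu : {bilinear n -> n -> n}) (omega : {skew_symmetric n}).
Hypothesis mu_lie : is_lie_bracket mu.
Hypothesis mu_nilp : is_nilpotent mu.
Hypothesis omega_symp : is_symplectic_structure mu omega.

(** [lower_central] is spanned by brackets of basis vectors only; bilinearity extends membership to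
    all brackets. *)
Lemma mem_lower_central k X Y :
  Y \in lower_central mu k -> mu X Y \in lower_central mu k.+1.
Proof.
move=> Yk; rewrite (coord_vbasis (memvf X)) (coord_vbasis Yk) linear_sumlz.
apply: memv_suml => i _; rewrite linear_sumr; apply: memv_suml => j _ /=.
rewrite linearZl_LR linearZr_LR /=; do 2!apply: memvZ.
by apply: memv_span; apply: allpairs_f; rewrite mem_nth // size_tuple.
Qed.

(* For a compatible metric in which [e] and [c] are orthonormal, (J e, J c, c, e)
   is an adapted frame. *)
Record central_flag (e c : n) : Prop := CentralFlag {
  flag_e_neq0 : e != 0;
  flag_mu_e : forall X, mu X e = 0;
  flag_omega : omega c e = 0;
  flag_c : c \notin <[e]>%VS;
  flag_mu_c : forall X, mu X c \in <[e]>%VS }.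

(** With a central entry [e], two of the three terms of the cocycle identity vanish: the derived
    algebra is [omega]-orthogonal to the center. *)
Lemma omega_bracket_central e X Y :
  (forall Z, mu Z e = 0) -> omega (mu X Y) e = 0.
Proof.
move=> mu_e; have [_ cocycle] := omega_symp.
have := cocycle X Y e.
by rewrite mu_e (bracketC mu_lie e) mu_e oppr0 !linear0l !addr0.
Qed.

(** Take [e] in the last nonzero term of the lower central series and let [W] be its
    [omega]-orthogonal. Choose [c] off the line of [e] in the deepest intersection of [W] with the
    series that leaves this line. Brackets with [c] fall one term deeper and stay in [W], hence lie
    on the line. *)
Lemma central_flag_exists : exists e c, central_flag e c.
Proof.
have [e e_neq0 mu_e] : exists2 e, e != 0 & forall X, mu X e = 0.
  have ex_k : exists k, lower_central mu k == 0%VS.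
    by case: mu_nilp => k k0; exists k; rewrite k0.
  (* Term [k.+1] is the first one that vanishes; index [0] would make the whole algebra zero. *)
  case: (ex_minnP ex_k) => -[|k] Ck0 minC.
    by move: dim_n; rewrite (eqP Ck0 : {:n}%VS = 0%VS) dimv0.
  exists (vpick (lower_central mu k)).
    by rewrite vpick0; apply/negP => /minC; rewrite ltnn.
  move=> X; apply/eqP; rewrite -memv0 -(eqP Ck0).
  exact/mem_lower_central/memv_pick.
pose W := orthov omega <[e]>%VS.
have memW X : (X \in W) = (omega X e == 0) by rewrite mem_orthov1.
have ex_k : exists k, (W :&: lower_central mu k <= <[e]>)%VS.
  by case: mu_nilp => k k0; exists k; rewrite k0 capv0 sub0v.
(* Index [0] is excluded by dimension: [W] has dimension at least 3 and cannot lie in a line. *)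
case: (ex_minnP ex_k) => -[|k] Wk minW.
  rewrite /= capvC in Wk; have := leq_trans (leq_dim_orthov1 omega e fullv) (dimvS Wk).
  by rewrite dim_n dim_vline e_neq0.
have /subvPn [c] : ~~ (W :&: lower_central mu k <= <[e]>)%VS.
  by apply/negP => /minW; rewrite ltnn.
rewrite memv_cap memW => /andP[/eqP ce ck] c_e; exists e, c; split=> // X.
apply: (subvP Wk); rewrite memv_cap memW omega_bracket_central // eqxx /=.
exact: mem_lower_central.
Qed.

(** The flag leaves unknown only the numbers [q] and [l] in the brackets with [c] and the four
    coordinates of [mu a b]. Orthogonality of brackets to [e] kills the [a]-coordinate [x], the
    cocycle identity on [a], [b], [c] gives [l = m], and nilpotency gives [m = 0]. *)
Lemma adapted_frame_of_flag a b c e : central_flag e c ->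
  darboux_frame omega a b c e -> exists s p q, adapted_frame mu omega a b c e s p q.
Proof.
move=> [e_neq0 mu_e ce c_e mu_c] abce; have [_ cocycle] := omega_symp.
have Bb := darboux_basis dim_n abce.
have [q acE] := vlineP _ _ (mu_c a).
have [l bcE] := vlineP _ _ (mu_c b).
have [x [m [s [p abE]]]] := comb_coord (mu a b) Bb.
have x0 : x = 0.
  have := omega_bracket_central a b mu_e; rewrite abE form_combl.
  by rewrite skewxx !(omega_ae abce, omega_be abce, omega_ce abce); lra.
have lm : l = m.
  have := cocycle a b c; rewrite (bracketC mu_lie c a) bcE acE abE form_combl.
  rewrite linearNl /= !linearZl_LR /= (skewC _ e a) (skewC _ e b) (skewC _ e c) skewxx.
  rewrite !(omega_ae abce, omega_be abce, omega_ce abce, omega_ac abce, omega_bc abce).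
  by lra.
(* Each application of [mu a] multiplies the [b]-coordinate by [m] and keeps the [a]-coordinate
   zero. The iterates of [b] descend the lower central series, so some power of [m] vanishes;
   pairing with [c] reads off this coordinate. *)
have m0 : m = 0.
  have [k0 Ck0] := mu_nilp.
  have iterE k : iter k (mu a) b \in lower_central mu k /\
      exists z w, iter k (mu a) b = comb a b c e 0 (m ^+ k) z w.
    elim: k => [|k [IHmem [z [w IH]]]] /=.
      by split; [exact: memvf | exists 0, 0; rewrite expr0 /comb !scale0r scale1r !addr0 add0r].
    split; first exact: mem_lower_central.
    exists (m ^+ k * s), (m ^+ k * p + z * q); rewrite IH {1}/comb !linearDr !linearZr_LR /=.
    rewrite mu_e abE acE x0 scaler0 addr0 scale0r add0r combZ.
    have -> : z *: (q *: e) = comb a b c e 0 0 0 (z * q).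
      by rewrite /comb !scale0r !add0r scalerA.
    by rewrite combD exprSr; congr comb; ring.
  have [] := iterE k0; rewrite Ck0 memv0 => /eqP -> [z [w zw]].
  have : omega 0 c = m ^+ k0.
    by rewrite zw form_combl skewxx (skewC _ e c) !(omega_bc abce, omega_ce abce); ring.
  by rewrite linear0l => /esym /eqP; rewrite expf_eq0 => /andP[_ /eqP].
exists s, p, q; split=> //; last by rewrite bcE lm m0 scale0r.
by rewrite abE x0 m0 /comb !scale0r !add0r.
Qed.

Lemma nondegenerate_dual e : e != 0 -> exists a, omega a e = 1.
Proof.
move=> e_neq0; have [/eqP rad0 _] := omega_symp.
have : e \notin orthov omega fullv by rewrite rad0 memv0.
case/mem_orthovPn => a _ ea; exists (- (omega e a)^-1 *: a).
rewrite linearZl_LR /= (skewC _ a e); field; exact: ea.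
Qed.

Lemma flag_c_neq0 e c : central_flag e c -> c != 0.
Proof. by case=> _ _ _ c_e _; apply: contraNneq c_e => ->; exact: mem0v. Qed.

(** Since [e] is central and isotropic, [c] matters only modulo [e]. This freedom serves both the
    symplectic and the metric orthogonalization. *)
Lemma flag_shift e c x : central_flag e c -> central_flag e (c - x *: e).
Proof.
move=> [e_neq0 mu_e ce c_e mu_c]; split=> // [||X].
- by rewrite linearBl linearZl_LR /= skewxx ce; ring.
- by apply: contra c_e => h; rewrite -(subrK (x *: e) c) memvD // memvZ // memv_line.
- by rewrite linearBr linearZr_LR /= mu_e scaler0 subr0.
Qed.

Lemma flag_scale e c x y : x != 0 -> y != 0 ->
  central_flag e c -> central_flag (x *: e) (y *: c).
Proof.
move=> x0 y0 [e_neq0 mu_e ce c_e mu_c].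
have lineE : <[x *: e]>%VS = <[e]>%VS.
  apply/eqP; rewrite eqEsubv -!memvE !memvZ ?memv_line //=.
  by apply/vlineP; exists x^-1; rewrite scalerA mulVf // scale1r.
split=> [|X|||X]; rewrite ?lineE.
- by rewrite scaler_eq0 negb_or x0.
- by rewrite linearZr_LR /= mu_e scaler0.
- by rewrite linearZl_LR linearZr_LR /= ce !mulr0.
- by apply: contra c_e => /(memvZ y^-1); rewrite scalerA mulVf // scale1r.
- by rewrite linearZr_LR /= memvZ.
Qed.

Lemma adapted_frame_exists :
  exists a b c e s p q, adapted_frame mu omega a b c e s p q.
Proof.
have [e [c0 flag0]] := central_flag_exists.
have [a0 ae] := nondegenerate_dual (flag_e_neq0 flag0).
(* As [omega a0 e = 1], this shift makes [omega a0 c] vanish. *)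
pose c := c0 - omega a0 c0 *: e.
have flag : central_flag e c by exact: flag_shift.
have [b0 bc] := nondegenerate_dual (flag_c_neq0 flag).
have ac : omega a0 c = 0 by rewrite /c linearBr linearZr_LR /= ae; ring.
have ce := flag_omega flag.
(* Symplectic Gram-Schmidt: the first correction makes [b] orthogonal to [e] and keeps
   [omega b c = 1] because [omega a0 c = 0]; the second makes [a] orthogonal to [b]. *)
pose b := b0 - omega b0 e *: a0; pose a := a0 + omega a0 b *: c.
have be : omega b e = 0 by rewrite linearBl linearZl_LR /= ae; ring.
have bc1 : omega b c = 1 by rewrite linearBl linearZl_LR /= ac bc; ring.
exists a, b, c, e; apply: adapted_frame_of_flag => //.
split=> //; rewrite /a linearDl linearZl_LR /=.
- by rewrite ae ce; ring.
- by rewrite (skewC _ c b) bc1; ring.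
- by rewrite ac skewxx; ring.
Qed.

(** Gram-Schmidt on [e] and [c] stays within central flags by [flag_shift] and [flag_scale].
    Compatibility makes [J] an isometry, so for the frame completed by [J e] and [J c] the Darboux
    and orthonormality conditions both follow from orthonormality of [c], [e] and from
    [omega c e = 0]. *)
Lemma compatible_adapted_frame (g : {dot n for idfun}) : compatible omega g ->
  exists a b c e s p q,
    adapted_frame mu omega a b c e s p q /\ orthonormal_frame g a b c e.
Proof.
move=> g_comp; have [e0 [c0 flag0]] := central_flag_exists.
have unit x : x != 0 -> exists2 k, k != 0 & g (k *: x) (k *: x) = 1.
  move=> /(@neq0_dnorm_gt0 _ _ _ g) gx; pose r := Num.sqrt (g x x).
  have r0 : r != 0 by rewrite sqrtr_eq0 -ltNge.
  exists r^-1; first by rewrite invr_eq0.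
  rewrite linearZl_LR linearZr_LR /= -(sqr_sqrtr (ltW gx)) -/r; field.
  by rewrite r0.
have [x x0 gee] := unit _ (flag_e_neq0 flag0); pose e := x *: e0.
have flag1 : central_flag e c0.
  by have := flag_scale x0 (oner_neq0 _) flag0; rewrite scale1r.
pose c1 := c0 - g c0 e *: e.
have flag2 : central_flag e c1 by exact: flag_shift.
have ce1 : g c1 e = 0 by rewrite linearBl linearZl_LR /= gee; ring.
have [y y0 gcc] := unit _ (flag_c_neq0 flag2); pose c := y *: c1.
have flag : central_flag e c.
  by have := flag_scale (oner_neq0 _) y0 flag2; rewrite scale1r.
have gce : g c e = 0 by rewrite linearZl_LR /= ce1 mulr0.
have ce := flag_omega flag.
pose J := J_op omega g.
have gJ X Y : g (J X) Y = omega Y X.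
  by rewrite riesz_linearP // => k u v; rewrite linearDl linearZl_LR.
have gJJ X Y : g (J X) (J Y) = g X Y.
  by rewrite gJ skewC -gJ /J g_comp linearNl opprK /= dotC.
have oJ X Y : omega (J X) Y = g X Y by rewrite -gJ gJJ dotC.
have abce : darboux_frame omega (J e) (J c) c e.
  split; rewrite ?oJ //; last by rewrite dotC.
  by rewrite dotC gJ skewC ce oppr0.
have [s [p [q abce']]] := adapted_frame_of_flag flag abce.
exists (J e), (J c), c, e, s, p, q; split=> //.
split; rewrite ?gJJ ?gJ //; rewrite ?skewxx //; first by rewrite dotC.
by rewrite skewC ce oppr0.
Qed.

End Frames.

(** * Minimal metrics *)

Section Normalization.
Variables (R : realType) (n : vectType R).
Hypothesis dim_n : \dim {:n} = 4%N.
Variables (mu : {bilinear n -> n -> n}) (omega : {skew_symmetric n}).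
Hypothesis mu_lie : is_lie_bracket mu.

Lemma orthonormal_frame_exists a b c e : basis_of {:n} [tuple a; b; c; e] ->
  exists g : {dot n for idfun}, orthonormal_frame g a b c e.
Proof.
case/metric_of_basis => g gE; exists g.
pose i0 := Ordinal (isT : 0 < 4)%N; pose i1 := Ordinal (isT : 1 < 4)%N.
pose i2 := Ordinal (isT : 2 < 4)%N; pose i3 := Ordinal (isT : 3 < 4)%N.
by split; [exact: (gE i0 i0) | exact: (gE i1 i1) | exact: (gE i2 i2)
  | exact: (gE i3 i3) | exact: (gE i0 i1) | exact: (gE i0 i2)
  | exact: (gE i0 i3) | exact: (gE i1 i2) | exact: (gE i1 i3) | exact: (gE i2 i3)].
Qed.

(* A shear in Sp(4) removes [p], and the torus element [a -> t a, e -> e / t]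
   with [t = s / q] then makes the two remaining structure constants equal. *)
Lemma balanced_frame a b c e s p q : s * q != 0 ->
  adapted_frame mu omega a b c e s p q ->
  exists a' b' c' e' u, adapted_frame mu omega a' b' c' e' u 0 u.
Proof.
rewrite mulf_eq0 negb_or => /andP[s0 q0] abce; pose V := comb a b c e.
have oE := omega_comb (adapted_darboux abce).
have muE := bracket_comb mu_lie abce.
(* The term [p / s] in the third vector absorbs [p], and [- p / q] in the first restores the
   [omega]-orthogonality of these two. Both structure constants become [s ^+ 2 / q]. *)
exists (V (s / q) (- p / q) 0 0), (V 0 1 0 0), (V 0 0 1 (p / s)), (V 0 0 0 (q / s)).
exists (s ^+ 2 / q); split=> [|||| X].
- by split; rewrite oE; field; rewrite ?s0 ?q0.
- by rewrite muE scale0r addr0 combZ; congr comb; field; rewrite ?s0 ?q0.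
- by rewrite muE combZ; congr comb; field; rewrite ?s0 ?q0.
- by rewrite muE /comb !mulr0 !mul0r !subr0 !mulr0 addr0 !scale0r !addr0.
- by rewrite /V /comb !scale0r !add0r linearZr_LR /= (mu_e abce) scaler0.
Qed.

(** Up to sign and scaling, the only double bracket of frame vectors is [mu a (mu a b)], equal to
    [s * q] times [e]. The right-hand side mentions no frame, so vanishing of [s * q] carries over
    from one adapted frame to any other. *)
Lemma adapted_frame_two_step a b c e s p q :
  adapted_frame mu omega a b c e s p q ->
  s * q = 0 <-> forall X Y Z, mu X (mu Y Z) = 0.
Proof.
move=> abce; split=> [sq0 X Y Z|two_step].
  have Bb := darboux_basis dim_n (adapted_darboux abce).
  have [x [y [z [w ->]]]] := comb_coord X Bb.
  have [x1 [y1 [z1 [w1 ->]]]] := comb_coord Y Bb.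
  have [x2 [y2 [z2 [w2 ->]]]] := comb_coord Z Bb.
  transitivity (comb a b c e 0 0 0 (s * q * (x * (x1 * y2 - y1 * x2)))).
    by rewrite !(bracket_comb mu_lie abce); congr comb; ring.
  by rewrite sq0 mul0r /comb !scale0r !addr0.
have := congr1 (omega a) (two_step a a b).
rewrite (mu_ab abce) linearDr !linearZr_LR /= (mu_ac abce) (mu_e abce) scaler0 addr0.
by rewrite scalerA linearZr_LR /= (omega_ae (adapted_darboux abce)) mulr1 linear0r.
Qed.

End Normalization.

Theorem mainTheorem1 (R : realType) (n : vectType R) (dim_n : \dim {:n} = 4%N)
    (mu : {bilinear n -> n -> n}) (mu_lie : is_lie_bracket mu)
    (mu_nilp : is_nilpotent mu)
    (omega : {skew_symmetric n}) (omega_symp : is_symplectic_structure mu omega) :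
  exists g : {dot n for idfun}, compatible omega g /\ minimal mu omega g.
Proof.
have [a0 [b0 [c0 [e0 [s0 [p0 [q0 frame0]]]]]]] :=
  adapted_frame_exists dim_n mu_lie mu_nilp omega_symp.
have [a [b [c [e [s [p [q [frame best]]]]]]]] : exists a b c e s p q,
    adapted_frame mu omega a b c e s p q /\
    (s * q = 0 \/ p = 0 /\ s = q).
  have [sq0|sq_neq0] := eqVneq (s0 * q0) 0.
    by exists a0, b0, c0, e0, s0, p0, q0; split=> //; left.
  have [a [b [c [e [u frame]]]]] := balanced_frame mu_lie sq_neq0 frame0.
  by exists a, b, c, e, u, 0, u; split=> //; right.
have [g g_frame] := orthonormal_frame_exists (darboux_basis dim_n (adapted_darboux frame)).
have g_comp := compatible_frame dim_n frame g_frame.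
exists g; do 2!split=> //; move=> g' g'_comp.
have [a' [b' [c' [e' [s' [p' [q' [frame' g'_frame]]]]]]]] :=
  compatible_adapted_frame dim_n mu_lie mu_nilp omega_symp g'_comp.
rewrite !(sc_frame dim_n mu_lie frame g_frame, sc_frame dim_n mu_lie frame' g'_frame).
rewrite (trace_Ric_ac_frame dim_n mu_lie frame g_frame).
rewrite (trace_Ric_ac_frame dim_n mu_lie frame' g'_frame) => sc_eq.
(* Equal scalar curvature means equal sums of squares, so only the terms [(s * q) ^+ 2] remain to be
   compared. *)
have -> : s ^+ 2 + p ^+ 2 + q ^+ 2 = s' ^+ 2 + p' ^+ 2 + q' ^+ 2 by lra.
case: best => [sq0|[p0' sq]].
  have sq0' : s' * q' = 0.
    apply/(adapted_frame_two_step dim_n mu_lie frame').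
    exact/(adapted_frame_two_step dim_n mu_lie frame).
  by rewrite sq0 sq0' lexx.
(* The difference of the two sides is [(s' ^+ 2 - q' ^+ 2) ^+ 2 + 2 * p' ^+ 2 * (s' ^+ 2 + q' ^+ 2)
   + p' ^+ 4]. *)
have le_sq : 4 * (s' * q') ^+ 2 <= (s' ^+ 2 + p' ^+ 2 + q' ^+ 2) ^+ 2.
  have := sqr_ge0 (s' ^+ 2 - q' ^+ 2); have := sqr_ge0 p'.
  have := sqr_ge0 s'; have := sqr_ge0 q'.
  by nra.
have eq_sq : 4 * (s * q) ^+ 2 = (s' ^+ 2 + p' ^+ 2 + q' ^+ 2) ^+ 2.
  have -> : s' ^+ 2 + p' ^+ 2 + q' ^+ 2 = 2 * s ^+ 2.
    by move: sc_eq; rewrite p0' -sq; lra.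
  by rewrite -sq; ring.
by lra.
Qed.
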